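(* Let $n\geq 2$. For any arithmetical structure on $S_n$ or on $K_n$, the invariant factor decomposition of its critical group has at most $n-2$ (nontrivial) components. Moreover, this bound is sharp: for each $n\ge 2$, both for $S_n$ and for $K_n$, there is an arithmetical structure whose critical group has exactly $n-2$ components in its invariant factor decomposition.
   Context: The invariant factor decomposition of a finite abelian group is its expression as $\bigoplus_{k=1}^t\mathbb{Z}/m_k\mathbb{Z}$ with $m_k>1$ and $m_k\mid m_{k+1}$; its number of components is $t$ (with $t=0$ for the trivial group). An arithmetical structure on a finite, connected, loopless graph $G$ with vertex set $V(G)$ is a pair $(\mathbf{d},\mathbf{r})$, where $\mathbf{r}=(r_v)_{v\in V(G)}$ consists of positive integers with no common factor, $\mathbf{d}=(d_v)_{v\in V(G)}$ consists of nonnegative integers, and for every vertex $v$ we have $r_vd_v=\sum r_u$, the sum being over all $u$ adjacent to $v$ (with multiplicity for multigraphs). Its critical group $\mathcal{K}(G;\mathbf{d},\mathbf{r})$ is the torsion part of the cokernel (over $\mathbb{Z}$) of the matrix $L(G,\mathbf{d})=\operatorname{diag}(\mathbf{d})-A(G)$, where $A(G)$ is the adjacency matrix of $G$. The star graph $S_n$ has $n$ leaves $v_1,\dotsc,v_n$, each joined by one edge to a central vertex $v_0$ (and no other edges). $K_n$ denotes the (simple) complete graph on $n$ vertices. *)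

(* Defs.v *)
From HB Require Import structures.
From mathcomp Require Import all_boot all_order all_algebra.
From mathcomp Require Import boolp.

Set Implicit Arguments.
Unset Strict Implicit.
Unset Printing Implicit Defensive.

Import GRing.Theory.

Local Open Scope ring_scope.

(* The vertices are numbered, V(G) = 'I_N, so that the
   Laplacian-type matrix is a MathComp matrix; mult u v is the number of edges
   joining u and v. *)
Record multigraph (N : nat) := Multigraph {
  mult : 'I_N -> 'I_N -> nat;
  mult_sym : forall u v, mult u v = mult v u;
  mult_loopless : forall v, mult v v = 0%N;
  mult_connected : forall u v, connect (fun x y => (0 < mult x y)%N) u v
}.

Record arith_structure (N : nat) (G : multigraph N) := ArithStructure {
  arith_d : 'I_N -> nat;
  arith_r : 'I_N -> nat;
  arith_r_gt0 : forall v, (0 < arith_r v)%N;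
  arith_r_coprime : \big[gcdn/0%N]_v arith_r v = 1%N;
  arith_rd : forall v,
    (arith_r v * arith_d v = \sum_u mult G v u * arith_r u)%N
}.

Definition adjmx (N : nat) (G : multigraph N) : 'M[int]_N :=
  \matrix_(u, v) (mult G u v)%:Z.

Definition laplacian (N : nat) (G : multigraph N) (d : 'I_N -> nat) :
  'M[int]_N := diag_mx (\row_v (d v)%:Z) - adjmx G.

Definition int_image (m n : nat) (M : 'M[int]_(m, n)) : {pred 'cV[int]_m} :=
  fun x => `[< exists u : 'cV[int]_n, x = M *m u >].

Lemma int_image_zmod_closed (m n : nat) (M : 'M[int]_(m, n)) :
  zmod_closed (int_image M).
Proof.
split=> [|_ _ /asboolP[u ->] /asboolP[v ->]]; apply/asboolP.
  by exists 0; rewrite mulmx0.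
by exists (u - v); rewrite mulmxBr.
Qed.

HB.instance Definition _ (m n : nat) (M : 'M[int]_(m, n)) :=
  GRing.isZmodClosed.Build _ (int_image M) (int_image_zmod_closed M).

Definition cokernel (m n : nat) (M : 'M[int]_(m, n)) : zmodType :=
  Quotient.quot (int_image M).

Definition is_torsion (A : zmodType) : {pred A} :=
  fun x => `[< exists2 k : nat, (0 < k)%N & x *+ k = 0 >].

Lemma is_torsion_zmod_closed (A : zmodType) : zmod_closed (@is_torsion A).
Proof.
split=> [|x y /asboolP[k k0 xk] /asboolP[l l0 yl]]; apply/asboolP.
  by exists 1%N.
exists (k * l)%N; first by rewrite muln_gt0 k0.
by rewrite mulrnBl mulrnA xk mul0rn mulnC mulrnA yl mul0rn subr0.
Qed.

HB.instance Definition _ (A : zmodType) :=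
  GRing.isZmodClosed.Build _ (@is_torsion A) (@is_torsion_zmod_closed A).

Record torsion (A : zmodType) :=
  Torsion { torsion_val : A; torsion_valP : torsion_val \in @is_torsion A }.

HB.instance Definition _ (A : zmodType) := [isSub for @torsion_val A].
HB.instance Definition _ (A : zmodType) := [Choice of torsion A by <:].
HB.instance Definition _ (A : zmodType) :=
  [SubChoice_isSubZmodule of torsion A by <:].

Definition critical_group (N : nat) (G : multigraph N)
  (s : arith_structure G) : zmodType :=
  torsion (cokernel (laplacian G (arith_d s))).

(* The integers m_1, ..., m_t are listed in m, so t = size m.  All of them
   exceed 1, hence 'Z_(m_k) is really the integers modulo m_k, and the dependent
   finite functions with pointwise addition form the direct sum of the 'Z_(m_k). *)
Definition invariant_factors (K : zmodType) (m : seq nat) : Prop :=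
  [/\ all (fun k => (1 < k)%N) m,
      sorted (fun a b => (a %| b)%N) m &
      exists2 f : K -> {dffun forall k : 'I_(size m), 'Z_(nth 0%N m k)},
        bijective f & forall x y k, f (x + y) k = f x k + f y k].

Section StarComplete.

Variable n : nat.

Definition star_mult (u v : 'I_n.+1) : nat := (u == ord0) (+) (v == ord0).

Lemma star_mult_sym u v : star_mult u v = star_mult v u.
Proof. by rewrite /star_mult addbC. Qed.

Lemma star_mult_loopless v : star_mult v v = 0%N.
Proof. by rewrite /star_mult addbb. Qed.

Lemma star_mult_connected u v :
  connect (fun x y => (0 < star_mult x y)%N) u v.
Proof.
suff c0 w : connect (fun x y => (0 < star_mult x y)%N) w ord0
         /\ connect (fun x y => (0 < star_mult x y)%N) ord0 w.
  by apply: connect_trans (c0 u).1 (c0 v).2.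
have [->|w0] := eqVneq w ord0; first by split; apply: connect0.
by split; apply: connect1; rewrite /star_mult (negbTE w0) eqxx.
Qed.

(* The vertex ord0 is the centre, the n others are the leaves. *)
Definition star : multigraph n.+1 :=
  Multigraph star_mult_sym star_mult_loopless star_mult_connected.

Definition complete_mult (u v : 'I_n) : nat := u != v.

Lemma complete_mult_sym u v : complete_mult u v = complete_mult v u.
Proof. by rewrite /complete_mult eq_sym. Qed.

Lemma complete_mult_loopless v : complete_mult v v = 0%N.
Proof. by rewrite /complete_mult eqxx. Qed.

Lemma complete_mult_connected u v :
  connect (fun x y => (0 < complete_mult x y)%N) u v.
Proof.
have [->|uv] := eqVneq u v; first exact: connect0.
by apply: connect1; rewrite /complete_mult uv.
Qed.

Definition complete : multigraph n :=
  Multigraph complete_mult_sym complete_mult_loopless complete_mult_connected.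

End StarComplete.

(* Main.v *)
Require Import Defs.
From mathcomp Require Import boolp.
From mathcomp Require Import all_boot all_order all_algebra.
From mathcomp Require Import ring zify.

(* The critical group is read off the Smith normal form P * diag(d) * Q of the
   Laplacian: its invariant factors are the |d_i| > 1.  Since r is in the
   kernel, some d_i vanishes.  For K_n the entry -1 forces d_0 to be a unit; for
   S_n a 2x2 minor equal to 1 forces d_0 and d_1 to be units.  In both cases at
   most n - 2 indices are left.  The number of components is well defined because
   it is the largest dimension of an F_p-vector space, p prime, onto which the
   group maps.

   Sharpness: take r = 1 on K_n, and r = n at the centre, 1 at the leaves of S_n.
   The Laplacian rows of any two vertices u, v of K_n (two leaves of S_n) then
   differ by n (e_u - e_v), so that differences of coordinates map the critical
   group onto F_p^(n-2) for p dividing n. *)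

Set Implicit Arguments.
Unset Strict Implicit.
Unset Printing Implicit Defensive.

Import Order.TTheory GRing.Theory Num.Theory.

Local Open Scope ring_scope.

(** * Representatives for the torsion of a cokernel *)

Section CokernelLift.

Local Open Scope quotient_scope.

(** Later arguments compute with integer vectors modulo the image of [M] and never return to the
    quotient. The four clauses make [rho] additive, torsion-valued, onto the torsion classes and
    injective, all modulo that image. *)
Lemma torsion_cokernel_lift (m n : nat) (M : 'M[int]_(m, n)) :
  exists rho : torsion (cokernel M) -> 'cV[int]_m,
  [/\ forall x y, exists u, rho (x + y) - (rho x + rho y) = M *m u,
      forall x, exists2 k, (0 < k)%N & exists u, rho x *+ k = M *m u,
      forall v k u, (0 < k)%N -> v *+ k = M *m u ->
        exists x, exists w, rho x - v = M *m w &
      forall x y u, rho x - rho y = M *m u -> x = y].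
Proof.
pose im := int_image M.
have eqE v w : (exists u, v - w = M *m u) <-> \pi_(cokernel M) v = \pi w.
  by split=> [/asboolP vw|/eqP vw]; [apply/eqP|apply/asboolP];
    move: vw; rewrite -(Quotient.idealrBE im).
have piMn v k : \pi_(cokernel M) (v *+ k) = \pi v *+ k by rewrite raddfMn.
exists (fun x => repr (torsion_val x)); split.
- move=> x y; apply/eqE; rewrite raddfD /= !reprK.
  exact: (raddfD (val : torsion (cokernel M) -> _)).
- move=> [x] /=; rewrite unfold_in => /asboolP[k k0 xk]; exists k => //.
  suff [u uP] : exists u, repr x *+ k - 0 = M *m u by exists u; rewrite -uP subr0.
  by apply/eqE; rewrite piMn reprK xk raddf0.
- move=> v k u k0 vk.
  have tv : \pi_(cokernel M) v \in @is_torsion (cokernel M).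
    rewrite unfold_in; apply/asboolP; exists k => //.
    rewrite -piMn -[RHS](raddf0 \pi_(cokernel M)); apply/eqE.
    by exists u; rewrite subr0.
  exists (Torsion tv) => /=.
  by apply/eqE; rewrite reprK.
- move=> x y u xy; apply: val_inj => /=.
  by rewrite -[LHS]reprK -[RHS]reprK; apply/eqE; exists u.
Qed.

End CokernelLift.

(** * The number of invariant factors *)

Lemma intZp_eq0 (m : nat) (z : int) : (1 < m)%N ->
  ((z%:~R : 'Z_m) == 0) = (m %| z)%Z.
Proof.
move=> m1.
have natE (k : nat) : ((k%:R : 'Z_m) == 0) = (m %| k)%N.
  by rewrite -val_eqE /= val_Zp_nat.
by case: z => k; rewrite ?NegzE ?mulrNz ?oppr_eq0 -pmulrn natE // dvdzE.
Qed.

(** The generators are the standard basis of the direct sum, pulled back along the isomorphism;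
    residues, read as naturals, are the coefficients. *)
Lemma invariant_factors_generators (K : zmodType) (m : seq nat) :
  invariant_factors K m ->
  exists x : 'I_(size m) -> K, forall y, exists c, y = \sum_k x k *+ c k.
Proof.
case=> _ _ [f [g fK gK] fD].
have f0 j : f 0 j = 0 by apply: (addrI (f 0 j)); rewrite -fD !addr0.
have fMn y c j : f (y *+ c) j = f y j *+ c.
  by elim: c => [|c IHc]; rewrite ?mulr0n // !mulrS fD IHc.
pose e k : {dffun forall k : 'I_(size m), 'Z_(nth 0%N m k)} :=
  finfun (fun j => (j == k)%:R).
exists (fun k => g (e k)) => y; exists (fun k => val (f y k)).
apply: (can_inj fK); apply/ffunP => j.
have fDj : {morph (fun y => f y j) : x y / x + y} by move=> *; rewrite fD.
rewrite (big_morph _ fDj (f0 j)).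
rewrite (bigD1 j) //= big1 => [|k kj]; rewrite fMn gK ffunE.
  by rewrite eqxx addr0 natr_Zp.
by rewrite eq_sym (negbTE kj) mul0rn.
Qed.

(** The images of the [size m] generators span the target space, so its dimension cannot exceed
    their number. *)
Lemma invariant_factors_ge (K : zmodType) (m : seq nat) (F : fieldType) (t : nat)
    (h : K -> 'rV[F]_t) :
  {morph h : x y / x + y} -> (forall v, exists x, h x = v) ->
  invariant_factors K m -> (t <= size m)%N.
Proof.
move=> hD hs /invariant_factors_generators[x xP].
have h0 : h 0 = 0 by apply: (addrI (h 0)); rewrite -hD !addr0.
have hMn y c : h (y *+ c) = h y *+ c.
  by elim: c => [|c IHc]; rewrite ?mulr0n // !mulrS hD IHc.
pose A := \matrix_k h (x k).
suff fullA : row_full A by rewrite -(eqP fullA) rank_leq_row.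
apply/row_fullP.
have /choice[B BP] v : exists w : 'rV_(size m), w *m A = v.
  have [y <-] := hs v; have [c ->] := xP y.
  exists (\row_k (c k)%:R).
  rewrite mulmx_sum_row (big_morph _ hD h0); apply: eq_bigr => k _.
  by rewrite rowK mxE hMn scaler_nat.
exists (\matrix_k B (row k 1%:M)); apply/row_matrixP => k.
by rewrite row_mul rowK BP.
Qed.

(** A prime factor [p] of the first entry of [m] divides all the others, so reducing each coordinate
    modulo [p] maps [K] onto a space over ['F_p] of dimension [size m]. The generators coming from
    [m'] must span it. *)
Lemma invariant_factors_size_le (K : zmodType) (m m' : seq nat) :
  invariant_factors K m -> invariant_factors K m' -> (size m <= size m')%N.
Proof.
case: m => [//|m0 m] [m1 ms [f [g fK gK] fD]].
set s := m0 :: m in m1 ms f g fK gK fD *.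
pose p := pdiv m0.
have p_pr : prime p by apply: pdiv_prime; case/andP: m1.
have pk (k : 'I_(size s)) : (p %| nth 0%N s k)%N.
  apply: dvdn_trans (pdiv_dvd m0) _.
  exact: (@sorted_leq_nth _ dvdn dvdn_trans dvdnn 0%N _ ms 0%N (val k) isT
    (ltn_ord k) (leq0n k)).
have mk1 (k : 'I_(size s)) : (1 < nth 0%N s k)%N by exact: (all_nthP 0%N m1).
have FpE a b : (a = b %[mod p])%N -> a%:R = b%:R :> 'F_p.
  by move=> ab; apply: val_inj; rewrite /= !val_Fp_nat.
apply: (@invariant_factors_ge _ _ 'F_p _ (fun x => \row_k (val (f x k))%:R)).
  move=> x y; apply/rowP => k; rewrite !mxE fD -natrD; apply: FpE.
  rewrite -[f x k in LHS]natr_Zp -[f y k in LHS]natr_Zp -natrD.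
  by rewrite [val _](val_Zp_nat (mk1 k)) modn_dvdm.
move=> v.
exists (g (finfun (fun k => (val (v 0 k))%:R))).
apply/rowP => k; rewrite !mxE gK ffunE -[RHS]natr_Zp; apply: FpE.
by rewrite [val _](val_Zp_nat (mk1 k)) modn_dvdm.
Qed.

(** * Cokernels through the Smith normal form *)

Lemma mul_diag_col (N : nat) (d : 'I_N -> int) (u : 'cV[int]_N) i :
  (diag_mx (\row_j d j) *m u) i 0 = d i * u i 0.
Proof. by rewrite mul_diag_mx !mxE. Qed.

Section Smith.

Variables (N : nat) (M P Q : 'M[int]_N) (d : 'I_N -> int).
Hypotheses (P_unit : P \in unitmx) (Q_unit : Q \in unitmx).
Hypothesis M_def : M = P *m diag_mx (\row_i d i) *m Q.

(** In the basis formed by the columns of [P], the image of [M] is the direct sum of the ideals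
    generated by the [d i]. *)
Lemma smith_image (y : 'cV[int]_N) :
  (exists u, P *m y = M *m u) <-> forall i, (d i %| y i 0%R)%Z.
Proof.
split=> [[u Pu] i|dy].
  have -> : y = diag_mx (\row_j d j) *m (Q *m u).
    by rewrite -[LHS](mulKmx P_unit) Pu M_def -!mulmxA mulKmx.
  by rewrite mul_diag_col dvdz_mulr.
exists (invmx Q *m \col_i (y i 0%R %/ d i)%Z).
rewrite M_def -!mulmxA mulKVmx //; congr (_ *m _); apply/colP => i.
by rewrite mul_diag_col mxE mulrC divzK.
Qed.

Lemma smith_torsion (y : 'cV[int]_N) :
  (exists2 k, (0 < k)%N & exists u, P *m y *+ k = M *m u) <->
  forall i, d i = 0 -> y i 0 = 0.
Proof.
have PyMn k : P *m y *+ k = P *m (y *+ k) by rewrite raddfMn.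
split=> [[k k0 [u]]|y0].
  rewrite PyMn => Pyu i di0.
  have /(_ i) : forall i, (d i %| (y *+ k)%R i 0%R)%Z.
    by apply/smith_image; exists u.
  rewrite di0 dvd0z mulmxnE mulrn_eq0 => /orP[/eqP k00|/eqP //].
  by rewrite k00 in k0.
(* The product of the nonzero [d i] kills every coordinate with [d i != 0]; the other coordinates
   vanish by assumption. *)
exists (\prod_(i | d i != 0%R) `|d i|)%N.
  by apply: prodn_cond_gt0 => i; rewrite absz_gt0.
rewrite PyMn; apply/smith_image => i; rewrite mulmxnE.
have [di0|di0] := eqVneq (d i) 0; first by rewrite y0 // mul0rn dvdz0.
rewrite -mulr_natr dvdz_mull // (bigD1 i) //= natrM dvdz_mulr //.
by rewrite pmulrn intz dvdzE.
Qed.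

(** Unit [d i] contribute nothing, and torsion classes have coordinate 0 where [d i = 0]. The
    remaining coordinates, reduced modulo [d i], give the isomorphism. *)
Lemma invariant_factors_smith :
  (forall i j : 'I_N, (i <= j)%N -> (d i %| d j)%Z) ->
  exists m : seq nat, invariant_factors (torsion (cokernel M)) m /\
    size m = #|[pred i | 1 < `|d i|]%N|.
Proof.
move=> d_dvd; pose A := [pred i | 1 < `|d i|]%N.
exists [seq `|d i|%N | i in A]; rewrite size_image; split=> //.
split; first by apply/allP => _ /imageP[i Ai ->].
  rewrite sorted_map /enum_mem sorted_filter //.
    by move=> y x z; apply: dvdn_trans.
  rewrite -enumT; have : sorted leq (map val (enum 'I_N)).
    by rewrite val_enum_ord iota_sorted.
  by rewrite sorted_map; apply: sub_sorted => i j /d_dvd; rewrite dvdzE.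
set m := image _ _; have [rho [rhoD rhoT rhoS rhoI]] := torsion_cokernel_lift M.
have szm : size m = #|A| by rewrite size_image.
pose idx (k : 'I_(size m)) := enum_val (cast_ord szm k).
have nth_m (k : 'I_(size m)) : nth 0%N m k = `|d (idx k)|%N.
  by rewrite -(nth_image 0%N (fun i => `|d i|%N)).
have m1 (k : 'I_(size m)) : (1 < nth 0%N m k)%N.
  by rewrite nth_m; apply: (enum_valP (cast_ord szm k)).
have ZmE (k : 'I_(size m)) z :
    (z%:~R == 0 :> 'Z_(nth 0%N m k)) = (d (idx k) %| z)%Z.
  by rewrite intZp_eq0 // nth_m !dvdzE.
pose y x := invmx P *m rho x.
have yK x : P *m y x = rho x by rewrite mulKVmx.
pose f x : {dffun forall k : 'I_(size m), 'Z_(nth 0%N m k)} :=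
  finfun (fun k => (y x (idx k) 0)%:~R).
have yT x i : d i = 0 -> y x i 0 = 0.
  by move: i; apply/smith_torsion; rewrite yK; apply: rhoT.
have fI : injective f.
  move=> a b /ffunP fab; have [|u uP] := (smith_image (y a - y b)).2 _; last first.
    by apply: (rhoI _ _ u); rewrite -uP mulmxBr !yK.
  have subE (u v : 'cV[int]_N) i : (u - v) i 0 = u i 0 - v i 0 by rewrite !mxE.
  move=> i; rewrite subE; have [di0|di0] := eqVneq (d i) 0.
    by rewrite !yT // subrr dvdz0.
  have [di1|] := leqP `|d i| 1.
    have/eqP di : `|d i|%N == 1%N by rewrite eqn_leq di1 absz_gt0.
    by rewrite dvdzE di dvd1n.
  move=> Ai; have Aj : i \in A by [].
  have := fab (cast_ord (esym szm) (enum_rank_in Aj i)).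
  rewrite !ffunE => /eqP; rewrite -subr_eq0 -rmorphB ZmE.
  by rewrite /idx cast_ordKV enum_rankK_in.
(* The lift [v] is supported on the indices with [|d i| > 1], hence vanishes where [d i = 0] and is
   torsion. *)
have fS g : exists x, f x = g.
  pose v : 'cV[int]_N := \sum_k (g k : nat)%:Z *: delta_mx (idx k) 0.
  have [|k k0 [u vu]] := (smith_torsion v).2 _.
    move=> i di0; rewrite summxE big1 // => k _; rewrite !mxE.
    have [ik|_] := eqVneq i (idx k); last by rewrite mulr0.
    by have := enum_valP (cast_ord szm k); rewrite -/(idx k) -ik inE di0.
  have [x [w xw]] := rhoS _ _ _ k0 vu; exists x; apply/ffunP => j.
  have vj : v (idx j) 0 = (g j : nat)%:Z.
    rewrite summxE (bigD1 j) //= big1 => [|i ij]; rewrite !mxE.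
      by rewrite !eqxx mulr1 addr0.
    rewrite (inj_eq enum_val_inj) (inj_eq (@cast_ord_inj _ _ _)) eq_sym (negbTE ij).
    by rewrite mulr0.
  rewrite ffunE -[RHS]natr_Zp pmulrn; apply/eqP; rewrite -subr_eq0 -rmorphB ZmE -vj.
  have -> : y x (idx j) 0 - v (idx j) 0 = (y x - v) (idx j) 0 by rewrite !mxE.
  by move: (idx j); apply/smith_image; exists w; rewrite mulmxBr yK.
have [g gP] := choice fS.
exists f; first by exists g => // x; apply: fI.
move=> a b k; have [u uP] := rhoD a b.
rewrite !ffunE -rmorphD; apply/eqP; rewrite -subr_eq0 -rmorphB ZmE.
have -> : y (a + b) (idx k) 0 - (y a (idx k) 0 + y b (idx k) 0)
  = (y (a + b) - (y a + y b)) (idx k) 0 by rewrite !mxE.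
by move: (idx k); apply/smith_image; exists u; rewrite mulmxBr mulmxDr !yK.
Qed.

(** The vector [Q *m r] is nonzero and killed by the diagonal matrix, so [d i = 0] at any of its
    nonzero coordinates. *)
Lemma smith_kernel (r : 'cV[int]_N) :
  r != 0 -> M *m r = 0 -> exists i, d i = 0.
Proof.
move=> r0 Mr; have /cV0Pn[i Qri] : Q *m r != 0.
  by apply: contra r0 => /eqP Qr; rewrite -(mulKmx Q_unit r) Qr mulmx0.
exists i; apply/eqP; have DQr : diag_mx (\row_j d j) *m (Q *m r) = 0.
  by rewrite -[LHS](mulKmx P_unit) (mulmxA P) (mulmxA _ Q) -M_def Mr mulmx0.
have /eqP := mul_diag_col d (Q *m r) i.
by rewrite DQr mxE eq_sym mulf_eq0 (negbTE Qri) orbF.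
Qed.

Lemma smith_entry i j : M i j = \sum_k P i k * d k * Q k j.
Proof. by rewrite M_def mxE; apply: eq_bigr => k _; rewrite mul_mx_diag !mxE. Qed.

End Smith.

Lemma smith_form (N : nat) (M : 'M[int]_N) :
  exists (P Q : 'M[int]_N) (d : 'I_N -> int),
  [/\ P \in unitmx, Q \in unitmx, M = P *m diag_mx (\row_i d i) *m Q &
      forall i j : 'I_N, (i <= j)%N -> (d i %| d j)%Z].
Proof.
have [P uP [Q uQ [d d_sorted ->]]] := int_Smith_normal_form M.
exists P, Q, (fun i => d`_i); split=> //.
  by congr (_ *m _ *m _); apply/matrixP => i j; rewrite !mxE.
(* Past the end of the list the default value is 0, which everything divides. *)
move=> i j le_ij; have [lt_jd|le_dj] := ltnP j (size d); last first.
  by rewrite [d`_j]nth_default ?dvdz0.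
have dvdz_tr : transitive dvdz by move=> y x z; apply: dvdz_trans.
apply: (sorted_leq_nth dvdz_tr dvdzz 0 d_sorted) => //.
exact: leq_ltn_trans lt_jd.
Qed.

(** With [e] the first diagonal coefficient, an entry of [M] equal to 1 or -1 makes that coefficient
    a unit. *)
Lemma smith_entry_dvd N (M P Q : 'M[int]_N) (d : 'I_N -> int) (e : int) :
  M = P *m diag_mx (\row_i d i) *m Q ->
  (forall i, e %| d i)%Z -> forall i j, (e %| M i j)%Z.
Proof.
move=> M_def ed i j; rewrite (smith_entry M_def).
by apply: rpred_sum => k _; rewrite dvdz_mulr // dvdz_mull.
Qed.

(* Modulo e, the matrix M has rank at most 1. *)
Lemma smith_minor_dvd N (M P Q : 'M[int]_N) (d : 'I_N -> int) (e : int) i0 :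
  M = P *m diag_mx (\row_i d i) *m Q ->
  (forall i, i != i0 -> e %| d i)%Z ->
  forall i j k l, (e %| (M i j * M k l - M i l * M k j)%R)%Z.
Proof.
move=> M_def ed i j k l; pose R a b := P a i0 * d i0 * Q i0 b.
have MR a b : exists x, M a b = R a b + e * x.
  have /dvdzP[x xP] : (e %| (M a b - R a b)%R)%Z.
    rewrite (smith_entry M_def) (bigD1 i0) //= addrAC subrr add0r.
    by apply: rpred_sum => c /ed ec; rewrite dvdz_mulr // dvdz_mull.
  by exists x; rewrite mulrC -xP addrC subrK.
have [x1 ->] := MR i j; have [x2 ->] := MR k l.
have [x3 ->] := MR i l; have [x4 ->] := MR k j.
(* The products [R i j * R k l] and [R i l * R k j] are equal and cancel; this is the rest, divided
   by [e]. *)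
apply/dvdzP; exists (R i j * x2 + x1 * R k l + e * x1 * x2
  - (R i l * x4 + x3 * R k j + e * x3 * x4)).
rewrite /R; ring.
Qed.

(** * Upper and lower bounds for the torsion of a cokernel *)

Lemma torsion_cokernel_size_le N (M P Q : 'M[int]_N) (d : 'I_N -> int)
    (A : {set 'I_N}) (r : 'cV[int]_N) :
  P \in unitmx -> Q \in unitmx -> M = P *m diag_mx (\row_i d i) *m Q ->
  (forall i j : 'I_N, (i <= j)%N -> (d i %| d j)%Z) ->
  (forall i, i \in A -> `|d i|%N = 1%N) -> r != 0 -> M *m r = 0 ->
  exists2 m, invariant_factors (torsion (cokernel M)) m &
    (size m <= N - #|A|.+1)%N.
Proof.
move=> uP uQ M_def d_dvd A1 r0 Mr.
have [m [mP m_size]] := invariant_factors_smith uP uQ M_def d_dvd.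
exists m => //; have [i0 di0] := smith_kernel uP uQ M_def r0 Mr.
(* The index [i0] of a zero coefficient lies outside [A], so [#|A|.+1] indices give no invariant
   factor. *)
have i0A : i0 \notin A by apply/negP => /A1; rewrite di0.
have <- : #|i0 |: A| = #|A|.+1 by rewrite cardsU1 i0A.
have <- : #|~: (i0 |: A)| = (N - #|i0 |: A|)%N by rewrite cardsCs setCK card_ord.
rewrite m_size; apply: subset_leq_card.
apply/subsetP => i; rewrite !inE negb_or => di.
by apply/andP; split; apply: contraL di; [move/eqP->; rewrite di0|move/A1->].
Qed.

(** Modulo a prime [p] dividing [q], the map [C] kills the image of [M], so it is defined on the
    cokernel. The columns of [S] are torsion, being killed by [q], and [C *m S = 1%:M] shows that
    [C] maps their classes to a basis over ['F_p]. *)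
Lemma torsion_cokernel_size_ge (N t q : nat) (M : 'M[int]_N)
    (C : 'M[int]_(t, N)) (S : 'M[int]_(N, t)) (m : seq nat) :
  (1 < q)%N -> C *m M = q%:R *: C -> M *m S = q%:R *: S -> C *m S = 1%:M ->
  invariant_factors (torsion (cokernel M)) m -> (t <= size m)%N.
Proof.
move=> q1 CM MS CS; have p_pr := pdiv_prime q1.
pose p := pdiv q; have q0 : q%:R = 0 :> 'F_p.
  by apply/eqP; rewrite -(dvdn_pcharf (pchar_Fp p_pr)) pdiv_dvd.
have [rho [rhoD _ rhoS _]] := torsion_cokernel_lift M.
pose c (x : 'cV[int]_N) : 'rV['F_p]_t := (map_mx intr (C *m x))^T.
have cD x y : c (x + y) = c x + c y by rewrite /c mulmxDr map_mxD raddfD.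
have cM u : c (M *m u) = 0.
  rewrite /c mulmxA CM -scalemxAl; apply/rowP => k.
  by rewrite !mxE rmorphM /= rmorph_nat q0 mul0r.
have c_eq x y u : x - y = M *m u -> c x = c y.
  by move=> xy; rewrite -(subrK y x) xy cD cM add0r.
apply: (@invariant_factors_ge _ _ 'F_p _ (fun x => c (rho x))).
  by move=> x y; have [u uP] := rhoD x y; rewrite -cD; apply: c_eq uP.
move=> v; pose w : 'cV[int]_t := \col_k (v 0 k : nat)%:Z.
have [|x [u xu]] := rhoS (S *m w) q (S *m w) (ltnW q1).
  by rewrite mulmxA MS -scalemxAl scaler_nat.
exists x; rewrite (c_eq _ _ _ xu) /c mulmxA CS mul1mx.
by apply/rowP => k; rewrite !mxE -pmulrn natr_Zp.
Qed.

(** * Laplacians and vertices with nearly equal rows *)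

Lemma laplacian_kernel N (G : multigraph N) (s : arith_structure G) :
  laplacian G (arith_d s) *m \col_v (arith_r s v)%:Z = 0.
Proof.
apply/colP => v; rewrite /laplacian mulmxBl mul_diag_mx !mxE.
rewrite -PoszM mulnC arith_rd (eq_bigr (fun u => (mult G v u * arith_r s u)%:Z)).
  by rewrite (big_morph Posz PoszD (erefl 0%:Z)) subrr.
by move=> u _; rewrite !mxE PoszM.
Qed.

Lemma arith_r_neq0 N (G : multigraph N.+1) (s : arith_structure G) :
  \col_v (arith_r s v)%:Z != 0.
Proof.
by apply/cV0Pn; exists ord0; rewrite mxE gt_eqF // ltz_nat arith_r_gt0.
Qed.

Lemma torsion_cokernel_twins_ge (N q : nat) (M : 'M[int]_N) (A : {set 'I_N})
    (m : seq nat) :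
  (1 < q)%N -> M^T = M ->
  {in A &, forall u v j, M u j - M v j = q%:R * ((j == u)%:R - (j == v)%:R)} ->
  invariant_factors (torsion (cokernel M)) m -> (#|A| - 2 <= size m)%N.
Proof.
move=> q1 MT MA mP.
have [//|A2] := leqP (#|A| - 2) 0; first by move/leq_trans; apply.
have [a aA] : exists a, a \in A by apply/card_gt0P; lia.
have [b] : exists b, b \in A :\ a.
  by apply/card_gt0P; move: A2; rewrite (cardsD1 a) aA; lia.
(* Two reference vertices are set aside: differences with [b] form the functionals [C], differences
   with [a] the torsion vectors [S]. *)
rewrite !inE => /andP[ba bA]; pose B := A :\ a :\ b.
have cardB : (#|A| - 2 = #|B|)%N.
  by rewrite (cardsD1 a) aA (cardsD1 b) !inE ba bA addnA addKn.
pose i (k : 'I_#|B|) := enum_val k.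
have iB k : [/\ i k != b, i k != a & i k \in A].
  by have := enum_valP k; rewrite !inE => /and3P[].
pose D c : 'M[int]_(#|B|, N) := \matrix_(k, j) ((j == i k)%:R - (j == c)%:R).
have D_mul p c (X : 'M[int]_(N, p)) k j : (D c *m X) k j = X (i k) j - X c j.
  have sumE u : \sum_l (l == u)%:R * X l j = X u j.
    rewrite (bigD1 u) //= big1 ?eqxx ?mul1r ?addr0 // => l /negbTE->.
    by rewrite mul0r.
  rewrite mxE -!sumE -sumrB; apply: eq_bigr => l _.
  by rewrite mxE mulrBl.
have DM c : c \in A -> D c *m M = q%:R *: D c.
  move=> cA; apply/matrixP => k j; have [_ _ kA] := iB k.
  by rewrite D_mul MA // !mxE.
(* As [a], [b] and the [i k] are distinct, [e_(i k) - e_b] and [e_(i l) - e_a] have inner product 1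
   if [k = l] and 0 otherwise. With a single reference vertex, each product would be larger by 1. *)
rewrite cardB; apply: (torsion_cokernel_size_ge (S := (D a)^T) q1 (DM b bA) _ _ mP).
  by rewrite -[M]MT -trmx_mul DM // linearZ.
apply/matrixP => k l; have [kb ka _] := iB k; have [lb _ _] := iB l.
rewrite D_mul !mxE (inj_eq enum_val_inj) (negbTE ka) (negbTE ba).
by rewrite eq_sym [b == _]eq_sym (negbTE lb) !subr0.
Qed.

Lemma laplacianE N (G : multigraph N) d u v :
  laplacian G d u v = (d u)%:Z *+ (u == v) - (mult G u v)%:Z.
Proof. by rewrite !mxE. Qed.

Lemma laplacian_sym N (G : multigraph N) d : (laplacian G d)^T = laplacian G d.
Proof.
apply/matrixP => u v; rewrite mxE !laplacianE mult_sym eq_sym.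
by have [->|] := eqVneq u v.
Qed.

(** * Complete graphs and stars *)

Lemma complete_size_le n (s : arith_structure (complete n.+2)) :
  exists2 m, invariant_factors (critical_group s) m & (size m <= n)%N.
Proof.
have [P [Q [d [uP uQ M_def d_dvd]]]] :=
  smith_form (laplacian (complete n.+2) (arith_d s)).
have d0 : `|d ord0|%N = 1%N.
  have := smith_entry_dvd M_def (fun i => d_dvd ord0 i (leq0n i)) ord0 ord_max.
  by rewrite laplacianE dvdzE /= dvdn1 => /eqP.
have [m mP sz_m] := torsion_cokernel_size_le (A := [set ord0]) uP uQ M_def
  d_dvd (fun i iA => etrans (congr1 _ (congr1 d (set1P iA))) d0)
  (arith_r_neq0 s) (laplacian_kernel s).
by exists m => //; move: sz_m; rewrite cards1 subn2.
Qed.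

Lemma star_size_le n (s : arith_structure (star n.+2)) :
  exists2 m, invariant_factors (critical_group s) m & (size m <= n)%N.
Proof.
have [P [Q [d [uP uQ M_def d_dvd]]]] :=
  smith_form (laplacian (star n.+2) (arith_d s)).
pose i1 : 'I_n.+3 := lift ord0 ord0.
have d1 : `|d i1|%N = 1%N.
  have ed i : i != ord0 -> (d i1 %| d i)%Z.
    by rewrite -val_eqE -lt0n => i0; apply: d_dvd.
  (* The minor on the rows of the centre and [i1] and the columns of [ord_max] and the centre is
     [(-1) * (-1) - 0], since the leaves [i1] and [ord_max] are distinct and not adjacent. *)
  have := smith_minor_dvd M_def ed ord0 ord_max i1 ord0.
  by rewrite !laplacianE !mulr0n subrr mulr0 subr0 dvdzE /= dvdn1 => /eqP.
have d0 : `|d ord0|%N = 1%N.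
  by apply/eqP; rewrite -dvdn1 -d1 -dvdzE; apply: d_dvd.
have [|m mP sz_m] := torsion_cokernel_size_le (A := [set ord0; i1]) uP uQ M_def
  d_dvd _ (arith_r_neq0 s) (laplacian_kernel s).
  by move=> i /set2P[]->.
by exists m => //; move: sz_m; rewrite cards2 subSS subn2.
Qed.

Lemma complete_size_ge n : exists s : arith_structure (complete n.+2),
  forall m, invariant_factors (critical_group s) m -> (n <= size m)%N.
Proof.
have r_coprime : \big[gcdn/0%N]_(v < n.+2) 1%N = 1%N.
  by apply/eqP; rewrite -dvdn1 (biggcdn_inf ord0).
have rd (v : 'I_n.+2) : (1 * n.+1 = \sum_u mult (complete n.+2) v u * 1)%N.
  rewrite (bigD1 v) //= /complete_mult eqxx mul0n add0n mul1n.
  rewrite (eq_bigr (fun=> 1%N)) => [|u]; last by rewrite eq_sym => ->.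
  by rewrite sum1_card cardC1 card_ord.
exists (@ArithStructure _ (complete n.+2) (fun=> n.+1) (fun=> 1%N) (fun=> isT)
  r_coprime rd) => m mP.
(* The Laplacian is [n.+2] times the identity minus the all-ones matrix, so all vertices qualify
   with [q = n.+2]. *)
have := torsion_cokernel_twins_ge (A := setT) (isT : 1 < n.+2)%N
  (laplacian_sym _ _) _ mP.
rewrite cardsT card_ord subn2; apply=> u v _ _ j.
rewrite !laplacianE /= /complete_mult ![j == _]eq_sym.
by case: (u == j); case: (v == j) => /=; lia.
Qed.

Lemma star_size_ge n : exists s : arith_structure (star n.+2),
  forall m, invariant_factors (critical_group s) m -> (n <= size m)%N.
Proof.
pose r (v : 'I_n.+3) := if v == ord0 then n.+2 else 1%N.
pose d (v : 'I_n.+3) := if v == ord0 then 1%N else n.+2.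
have r_gt0 v : (0 < r v)%N by rewrite /r; case: ifP.
have r_coprime : \big[gcdn/0%N]_v r v = 1%N.
  by apply/eqP; rewrite -dvdn1 (biggcdn_inf ord_max).
have rd v : (r v * d v = \sum_u mult (star n.+2) v u * r u)%N.
  rewrite (bigD1 ord0) //= /star_mult /r /d eqxx.
  have [_|v0] := boolP (v == ord0) => /=.
    rewrite (eq_bigr (fun=> 1%N)) => [|u /negbTE-> //].
    by rewrite sum1_card cardC1 card_ord muln1.
  by rewrite big1 => [|u /negbTE-> //]; rewrite addn0.
exists (ArithStructure r_gt0 r_coprime rd) => m mP.
(* The rows of two leaves agree in the central column, and each leaf has diagonal entry [n.+2]. *)
have := torsion_cokernel_twins_ge (A := [set~ ord0]) (isT : 1 < n.+2)%N
  (laplacian_sym _ _) _ mP.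
rewrite cardsC1 card_ord subn2; apply=> u v.
rewrite !inE => u0 v0 j; rewrite !laplacianE /= /star_mult /d.
rewrite (negbTE u0) (negbTE v0) ![j == _]eq_sym.
by case: (u == j); case: (v == j) => /=; lia.
Qed.

Theorem proposition16 (n : nat) (hn : (2 <= n)%N) :
  [/\ forall s : arith_structure (star n),
        (exists m : seq nat, invariant_factors (critical_group s) m) /\
        (forall m : seq nat,
           invariant_factors (critical_group s) m -> (size m <= n - 2)%N),
      forall s : arith_structure (complete n),
        (exists m : seq nat, invariant_factors (critical_group s) m) /\
        (forall m : seq nat,
           invariant_factors (critical_group s) m -> (size m <= n - 2)%N),
      exists (s : arith_structure (star n)) (m : seq nat),
        invariant_factors (critical_group s) m /\ size m = (n - 2)%N &
      exists (s : arith_structure (complete n)) (m : seq nat),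
        invariant_factors (critical_group s) m /\ size m = (n - 2)%N].
Proof.
case: n hn => [|[|n]] // _; rewrite subn2 /=; split.
- move=> s; have [m mP sz_m] := star_size_le s; split; first by exists m.
  (* The bound for the one decomposition [m] carries over to every decomposition [m']. *)
  by move=> m' /invariant_factors_size_le/(_ mP)/leq_trans; apply.
- move=> s; have [m mP sz_m] := complete_size_le s; split; first by exists m.
  by move=> m' /invariant_factors_size_le/(_ mP)/leq_trans; apply.
- have [s sP] := star_size_ge n; have [m mP sz_m] := star_size_le s.
  by exists s, m; split=> //; apply/eqP; rewrite eqn_leq sz_m sP.
- have [s sP] := complete_size_ge n; have [m mP sz_m] := complete_size_le s.
  by exists s, m; split=> //; apply/eqP; rewrite eqn_leq sz_m sP.
Qed.
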